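(* Let $G=(V,E)$ be a Gaussian tree, let $a\neq c$ be two vertices of $G$, and let $Z_1,Z_2\subseteq V$ be such that $\{a,c\}\not\perp\!\!\!\perp Z_2\mid Z_1$ and $\{a,c\}\not\perp\!\!\!\perp Z_1\mid Z_2$. Suppose further that $Z_1\cup Z_2$ contains no vertex of the unique path in $G$ joining $a$ and $c$ (endpoints included). Then there exists a covariance matrix $\Sigma_1$, compatible with the tree $G$, for which $\rho^2_{ac\mid Z_1}>\rho^2_{ac\mid Z_2}$, and there exists a covariance matrix $\Sigma_2$, compatible with the tree $G$, for which $\rho^2_{ac\mid Z_2}>\rho^2_{ac\mid Z_1}$.
   Context: Let $G=(V,E)$ be a finite undirected tree. A positive definite matrix $\Sigma$ indexed by $V$ is compatible with $G$ if under $N(0,\Sigma)$, for pairwise disjoint $T_1,T_2,T_3\subseteq V$, $T_1$ and $T_2$ are conditionally independent given $T_3$ whenever $T_3$ separates $T_1$ from $T_2$ in $G$, i.e. every path from a vertex of $T_1$ to a vertex of $T_2$ intersects $T_3$. A Gaussian tree is a tree $G$ together with a Gaussian random vector indexed by $V$ whose covariance matrix is compatible with $G$. $X\not\perp\!\!\!\perp Y\mid W$ means that conditional independence of $X$ and $Y$ given $W$ fails for the distribution of the Gaussian tree; conditional independence is equivalent to $\Sigma_{XY}-\Sigma_{XW}\Sigma_{WW}^{-1}\Sigma_{WY}=0$. For a positive definite $\Sigma$, distinct $u,v$ and $Z\subseteq V\setminus\{u,v\}$ the squared partial correlation is $$\rho^2_{uv\mid Z}=\frac{(\sigma_{uv}-\Sigma_{uZ}\Sigma_{ZZ}^{-1}\Sigma_{Zv})^2}{(\sigma_{uu}-\Sigma_{uZ}\Sigma_{ZZ}^{-1}\Sigma_{Zu})(\sigma_{vv}-\Sigma_{vZ}\Sigma_{ZZ}^{-1}\Sigma_{Zv})},$$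 where $\sigma_{uv}$ is the $(u,v)$ entry of $\Sigma$ and $\Sigma_{uZ}$ etc. are submatrices; for $Z=\emptyset$ the correction terms are absent. *)

(* Defs.v *)
From mathcomp Require Import all_boot all_order all_algebra.
From mathcomp Require Import reals sequences exp trigo.
Set Implicit Arguments.
Unset Strict Implicit.
Unset Printing Implicit Defensive.
Import Order.TTheory GRing.Theory Num.Theory.
Local Open Scope ring_scope.

Definition simple_path (V : finType) (e : rel V) (x y : V) (p : seq V) : bool :=
  [&& path e x p, uniq (x :: p) & last x p == y].

(* The size condition excludes the closed walks [:: x; y] along one edge,
   which ucycle accepts. *)
Definition is_tree (V : finType) (e : rel V) : Prop :=
  [/\ symmetric e, irreflexive e, forall x y, connect e x y
    & forall p : seq V, (2 < size p)%N -> ~ ucycle e p].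

Definition separates (V : finType) (e : rel V) (T1 T2 T3 : {set V}) : Prop :=
  forall x y p, x \in T1 -> y \in T2 -> simple_path e x y p ->
    has (mem T3) (x :: p).

Definition posdef (R : realType) (n : nat) (S : 'M[R]_n) : Prop :=
  S^T = S /\ forall x : 'rV[R]_n, x != 0 -> 0 < (x *m S *m x^T) 0 0.

(* A matrix indexed by V is a square matrix of size #|V|, the vertex v being
   the index enum_rank v; a matrix indexed by A x B with A, B : {set V} is
   likewise a #|A| x #|B| matrix. *)
Definition entry (R : realType) (V : finType) (S : 'M[R]_#|V|) (u v : V) : R :=
  S (enum_rank u) (enum_rank v).

Definition submat (R : realType) (V : finType) (S : 'M[R]_#|V|)
    (A B : {set V}) : 'M[R]_(#|A|, #|B|) :=
  \matrix_(i, j) entry S (enum_val i) (enum_val j).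

Definition subvec (R : realType) (V : finType) (x : V -> R) (A : {set V}) :
    'rV[R]_#|A| :=
  \row_i x (enum_val i).

(* Density of N(0, S) for a positive definite S; equal to 1 for n = 0. *)
Definition normal_density (R : realType) (n : nat) (S : 'M[R]_n)
    (x : 'rV[R]_n) : R :=
  expR (- (x *m invmx S *m x^T) 0 0 / 2) / Num.sqrt ((2 * pi) ^+ n * \det S).

(* Density at the point (x v), v in A, of the subvector X_A of X ~ N(0, S);
   X_A has distribution N(0, S_AA). *)
Definition marginal_density (R : realType) (V : finType) (S : 'M[R]_#|V|)
    (A : {set V}) (x : V -> R) : R :=
  normal_density (submat S A A) (subvec x A).

(* X_A and X_B are conditionally independent given X_C under N(0, S), S
   positive definite: f_ABC f_C = f_AC f_BC, pointwise since the densities are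
   continuous. A and B are to be disjoint; C may meet A or B, and then this is
   the conditional independence of X_(A \ C) and X_(B \ C) given X_C. *)
Definition cond_indep (R : realType) (V : finType) (S : 'M[R]_#|V|)
    (A B C : {set V}) : Prop :=
  forall x : V -> R,
    marginal_density S (A :|: B :|: C) x * marginal_density S C x
    = marginal_density S (A :|: C) x * marginal_density S (B :|: C) x.

(* The covariance matrices compatible with the graph (V, e). *)
Definition compatible (R : realType) (V : finType) (e : rel V)
    (S : 'M[R]_#|V|) : Prop :=
  posdef S /\
  forall T1 T2 T3 : {set V},
    [disjoint T1 & T2] -> [disjoint T1 & T3] -> [disjoint T2 & T3] ->
    separates e T1 T2 T3 -> cond_indep S T1 T2 T3.

(* sigma_uv - S_uZ S_ZZ^-1 S_Zv; for Z = set0 the product of empty matrices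
   is 0. *)
Definition partial_cov (R : realType) (V : finType) (S : 'M[R]_#|V|)
    (Z : {set V}) (u v : V) : R :=
  entry S u v
  - ((\row_(j < #|Z|) entry S u (enum_val j)) *m invmx (submat S Z Z)
     *m (\col_(i < #|Z|) entry S (enum_val i) v)) 0 0.

Definition partial_corr2 (R : realType) (V : finType) (S : 'M[R]_#|V|)
    (Z : {set V}) (u v : V) : R :=
  partial_cov S Z u v ^+ 2 / (partial_cov S Z u u * partial_cov S Z v v).

(* Main.v *)
Require Import Defs.
From mathcomp Require Import all_boot all_order all_algebra.
From mathcomp Require Import reals.
From mathcomp Require Import perm boolp sequences exp trigo.
From mathcomp Require Import zify ring lra.

(** [Z2] depends on the pair [a, c] given [Z1], so some path runs from [a] or [c]
    to [Z2] avoiding [Z1].  Let [h] be the vertex at which it leaves the path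
    from [a] to [c] for the last time and [z] the first vertex of [Z2] after
    [h].  Keep only the correlations along the star with centre [h] and ends
    [a], [c], [z], and make all other vertices independent; then [Z1] is
    independent of [a, c], while [Z2] acts on them through [z] alone.
    Conditioning on [z] removes the same fraction [o > 0] of the variance of [h]
    and of the covariance of [a] and [c], but only [xi * o] and [eta * o] of the
    variances of [a] and [c], where [xi] and [eta] are the squared correlations
    of [a] and [c] with [h]; these are not both 1, so the squared correlation
    decreases strictly.

    The covariance matrix is the inverse of a precision matrix supported on the
    edges of the star.  Such an inverse is Markov: if [D] separates [u] from [b],
    the residual of [u] after regression on [D] is uncorrelated with [b]; the
    densities then factor by adding the vertices one at a time. *)

Set Implicit Arguments.
Unset Strict Implicit.
Unset Printing Implicit Defensive.
Import Order.TTheory GRing.Theory Num.Theory.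
Local Open Scope ring_scope.

(** * Sums, subvectors and submatrices indexed by vertices *)

Lemma sum_ord_entry (R : realType) (V : finType) (F : 'I_#|V| -> R) :
  \sum_i F i = \sum_v F (enum_rank v).
Proof.
rewrite (reindex enum_rank) //=; apply: onW_bij; exact: enum_rank_bij.
Qed.

Lemma entry_sym (R : realType) (V : finType) (S : 'M[R]_#|V|) (u v : V) :
  posdef S -> entry S u v = entry S v u.
Proof. by case=> sS _; rewrite /entry -[in LHS]sS mxE. Qed.

Lemma entry_form (R : realType) (V : finType) (S : 'M[R]_#|V|) (x : 'rV_#|V|) :
  (x *m S *m x^T) 0 0 =
  \sum_v (\sum_u x 0 (enum_rank u) * entry S u v) * x 0 (enum_rank v).
Proof.
rewrite mxE sum_ord_entry; apply: eq_bigr => v _.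
by rewrite !mxE sum_ord_entry.
Qed.

Lemma posdef_form (R : realType) (V : finType) (S : 'M[R]_#|V|) (f : V -> R) (u0 : V) :
  posdef S -> f u0 != 0 ->
  0 < \sum_v (\sum_u f u * entry S u v) * f v.
Proof.
case=> _ pS fu0.
pose x : 'rV[R]_#|V| := \row_i f (enum_val i).
have xE v : x 0 (enum_rank v) = f v by rewrite mxE enum_rankK.
have x0 : x != 0.
  by apply: contra fu0 => /eqP x0; rewrite -xE x0 mxE.
have := pS _ x0; rewrite entry_form.
suff -> : \sum_v (\sum_u x 0 (enum_rank u) * entry S u v) * x 0 (enum_rank v) =
   \sum_v (\sum_u f u * entry S u v) * f v by [].
by apply: eq_bigr => v _; rewrite xE; congr (_ * _); apply: eq_bigr => u _; rewrite xE.
Qed.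

(** Row vectors indexed by [D] are traded for functions on all of [V] that vanish off [D]. Sums then
    range over [V] whatever [D] is, so sets of different sizes can be compared. *)
Lemma subvec_onto (R : realType) (V : finType) (D : {set V}) (v : 'rV[R]_#|D|) :
  exists f : V -> R, (forall w, w \notin D -> f w = 0) /\ subvec f D = v.
Proof.
exists (fun w => \sum_(i | enum_val i == w) v 0 i); split=> [w wD|].
  rewrite big1 // => i /eqP iw; case/negP: wD; rewrite -iw; exact: enum_valP.
apply/rowP=> i; rewrite mxE (big_pred1 i) // => j /=.
by rewrite (inj_eq enum_val_inj).
Qed.

Lemma subvec_mul_submat (R : realType) (V : finType) (S : 'M[R]_#|V|) (D E : {set V})
    (f : V -> R) : (forall w, w \notin D -> f w = 0) ->
  subvec f D *m submat S D E =
  subvec (fun v => \sum_w f w * entry S w v) E.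
Proof.
move=> fD; apply/rowP=> i; rewrite !mxE.
under eq_bigr => j _ do rewrite !mxE.
rewrite -(big_enum_val (fun w => f w * entry S w (enum_val i))) /=.
rewrite [RHS](bigID (mem D)) /= [X in _ = _ + X]big1 ?addr0 // => w wD.
by rewrite fD // mul0r.
Qed.

Lemma subvec_dot (R : realType) (V : finType) (D : {set V}) (f x : V -> R) :
  (forall w, w \notin D -> f w = 0) ->
  (subvec f D *m (subvec x D)^T) 0 0 = \sum_w f w * x w.
Proof.
move=> fD; rewrite mxE.
under eq_bigr => j _ do rewrite !mxE.
rewrite -(big_enum_val (fun w => f w * x w)) /=.
rewrite [RHS](bigID (mem D)) /= [X in _ = _ + X]big1 ?addr0 // => w wD.
by rewrite fD // mul0r.
Qed.

(** A null vector of the submatrix, extended by 0, would make the quadratic form of [S] vanish. *)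
Lemma submat_unit (R : realType) (V : finType) (S : 'M[R]_#|V|) (D : {set V}) :
  posdef S -> submat S D D \in unitmx.
Proof.
move=> pS; rewrite -row_free_unit; apply: inj_row_free => v v0.
have [f [fD fv]] := subvec_onto v.
suff f0 w : f w = 0 by rewrite -fv; apply/rowP=> i; rewrite !mxE.
apply/eqP/negPn/negP => fw.
have := posdef_form pS fw; rewrite big1 ?ltxx // => u _.
have [uD|uD] := boolP (u \in D); last by rewrite fD // mulr0.
have := subvec_mul_submat S D fD; rewrite fv v0.
move=> /rowP/(_ (enum_rank_in uD u)); rewrite !mxE enum_rankK_in // => <-.
by rewrite mul0r.
Qed.

(** * Regression on a set of vertices *)

(* [f] is [x_D S_DD^-1] extended by 0 outside [D]. *)
Definition regresses (R : realType) (V : finType) (S : 'M[R]_#|V|) (D : {set V})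
    (x f : V -> R) : Prop :=
  (forall v, v \notin D -> f v = 0) /\
  (forall v, v \in D -> \sum_w f w * entry S w v = x v).

Lemma regresses_exists (R : realType) (V : finType) (S : 'M[R]_#|V|) (D : {set V})
    (x : V -> R) : posdef S -> exists f, regresses S D x f.
Proof.
move=> pS; have uS := submat_unit D pS.
have [f [fD fE]] := @subvec_onto _ _ D (subvec x D *m invmx (submat S D D)).
exists f; split=> // v vD.
have := subvec_mul_submat S D fD; rewrite fE mulmxKV //.
by move=> /rowP/(_ (enum_rank_in vD v)); rewrite !mxE enum_rankK_in.
Qed.

Lemma regresses_subvec (R : realType) (V : finType) (S : 'M[R]_#|V|) (D : {set V})
    (x f : V -> R) : posdef S -> regresses S D x f ->
  subvec x D *m invmx (submat S D D) = subvec f D.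
Proof.
move=> pS [fD fE]; have uS := submat_unit D pS.
rewrite -[RHS](mulmxK uS) subvec_mul_submat //; congr (_ *m _).
by apply/rowP=> i; rewrite !mxE fE // enum_valP.
Qed.

Lemma partial_covE (R : realType) (V : finType) (S : 'M[R]_#|V|) (D : {set V})
    (u v : V) (f : V -> R) :
  posdef S -> regresses S D (entry S u) f ->
  partial_cov S D u v = entry S u v - \sum_w f w * entry S w v.
Proof.
move=> pS rf; rewrite /partial_cov; congr (_ - _).
have := regresses_subvec pS rf; rewrite /subvec => ->.
rewrite -(@subvec_dot _ _ D f (fun w => entry S w v)); last by case: rf.
by congr ((_ *m _) _ _); apply/matrixP=> i j; rewrite !mxE.
Qed.

(* The quadratic form of [S] is evaluated at the residual [e_u - f], which is
   orthogonal to [D]. *)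
Lemma residual_var_gt0 (R : realType) (V : finType) (S : 'M[R]_#|V|) (D : {set V})
    (u : V) (f : V -> R) :
  posdef S -> u \notin D -> regresses S D (entry S u) f ->
  0 < entry S u u - \sum_w f w * entry S w u.
Proof.
move=> pS uD [fD fE].
pose g v := (v == u)%:R - f v.
have gu : g u = 1 by rewrite /g eqxx fD // subr0.
have gS v : \sum_w g w * entry S w v =
            entry S u v - \sum_w f w * entry S w v.
  under eq_bigr => w _ do rewrite mulrBl.
  rewrite big_split /= sumrN; congr (_ - _).
  rewrite (bigD1 u) //= eqxx mul1r big1 ?addr0 // => w /negbTE ->.
  by rewrite mul0r.
have := @posdef_form _ _ S g u pS; rewrite gu oner_eq0 => /(_ isT).
rewrite (bigD1 u) //= gu mulr1 gS [X in _ + X]big1 ?addr0 // => v vu.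
have [vD|vD] := boolP (v \in D); first by rewrite gS fE // subrr mul0r.
by rewrite /g (negbTE vu) fD // subrr mulr0.
Qed.

(** * Determinants and marginal densities *)

(** Rows and columns undergo the same permutation, so its sign occurs squared. This frees
    determinants from the order in which [submat] enumerates a set. *)
Lemma det_reindex (R : realType) (m n : nat) (A : 'M[R]_n) (f : 'I_m -> 'I_n) :
  m = n -> injective f -> \det (\matrix_(i, j) A (f i) (f j)) = \det A.
Proof.
move=> emn; subst m => inj_f.
have -> : \matrix_(i, j) A (f i) (f j) =
          row_perm (perm inj_f) (col_perm (perm inj_f) A).
  by apply/matrixP=> i j; rewrite !mxE !permE.
rewrite row_permE col_permE !det_mulmx !det_perm odd_permV.
by rewrite mulrCA -expr2 sqrr_sign mulr1.
Qed.

(* The Schur complement of [submat S D D] is the residual variance of [u]. *)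
Lemma det_submat_setU1 (R : realType) (V : finType) (S : 'M[R]_#|V|) (D : {set V})
    (u : V) (f : V -> R) :
  posdef S -> u \notin D -> regresses S D (entry S u) f ->
  \det (submat S (u |: D) (u |: D)) =
  (entry S u u - \sum_w f w * entry S w u) * \det (submat S D D).
Proof.
move=> pS uD rf; have uS := submat_unit D pS.
(* [g] lists [u |: D] with [u] first, and [h] translates this list into the enumeration used by
   [submat]. *)
pose g (k : 'I_(1 + #|D|)) : V :=
  match split k with inl _ => u | inr j => enum_val j end.
have gl k : g (lshift _ k) = u by rewrite /g (unsplitK (inl _)).
have gr k : g (rshift _ k) = enum_val k by rewrite /g (unsplitK (inr _)).
have gD k : g k \in u |: D.
  case: (split_ordP k) => j ->; first by rewrite gl setU11.
  by rewrite gr setU1r // enum_valP.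
have g_inj : injective g.
  move=> k l; case: (split_ordP k) => i ->; case: (split_ordP l) => j ->;
    rewrite ?gl ?gr.
  - by rewrite !ord1.
  - by move=> E; case/negP: uD; rewrite E enum_valP.
  - by move=> E; case/negP: uD; rewrite -E enum_valP.
  - by move/enum_val_inj ->.
pose h k := enum_rank_in (gD k) (g k).
have hK k : enum_val (h k) = g k by rewrite enum_rankK_in.
have h_inj : injective h by move=> k l E; apply: g_inj; rewrite -!hK E.
rewrite -(det_reindex _ _ h_inj) //; last by rewrite cardsU1 uD.
pose r : 'rV_#|D| := subvec (entry S u) D.
pose M := submat S D D.
pose sc := entry S u u - \sum_w f w * entry S w u.
(* Block elimination: since [f] times [M] is [r], adding [f] times the rows of [D] to the row
   [(sc, 0)] gives back the row of [u]. *)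
have -> : \matrix_(i, j) submat S (u |: D) (u |: D) (h i) (h j) =
   block_mx (1%:M : 'M_1) (subvec f D) 0 1%:M *m block_mx sc%:M 0 r^T M.
  rewrite mulmx_block !mul1mx !mul0mx !add0r.
  have -> : subvec f D *m M = r.
    by rewrite -(regresses_subvec pS rf) mulmxKV.
  have -> : sc%:M + subvec f D *m r^T = (entry S u u)%:M.
    apply/rowP=> i; rewrite ord1 mxE subvec_dot; last by case: rf.
    rewrite !mxE eqxx !mulr1n /sc.
    under [X in _ + X]eq_bigr => w _ do rewrite (entry_sym _ _ pS).
    by rewrite subrK.
  apply/matrixP=> k l; rewrite !mxE !hK.
  case: (split_ordP k) => i ->; case: (split_ordP l) => j ->; rewrite ?gl ?gr.
  - by rewrite row_mxEl !mxE !ord1 eqxx.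
  - by rewrite row_mxEr !mxE.
  - by rewrite row_mxEl !mxE (entry_sym _ _ pS).
  - by rewrite row_mxEr !mxE.
by rewrite det_mulmx det_ublock det_lblock !det1 !mul1r det_scalar expr1.
Qed.

(** Each added vertex multiplies the determinant by a positive residual variance. *)
Lemma det_submat_gt0 (R : realType) (V : finType) (S : 'M[R]_#|V|) (D : {set V}) :
  posdef S -> 0 < \det (submat S D D).
Proof.
move=> pS; have [n] := ubnP #|D|; elim: n D => // n IH D cD.
have [D0|[u uD]] := set_0Vmem D.
  move: (submat S D D); rewrite D0 cards0 => M.
  by rewrite det_mx00.
rewrite -(setD1K uD).
have uD' : u \notin D :\ u by rewrite !inE eqxx.
have [f rf] := regresses_exists (D :\ u) (entry S u) pS.
rewrite (det_submat_setU1 pS uD' rf) // mulr_gt0 //.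
  exact: (residual_var_gt0 pS uD' rf).
by apply: IH; move: cD; rewrite (cardsD1 u) uD.
Qed.

Lemma quad_form_submat (R : realType) (V : finType) (S : 'M[R]_#|V|) (D : {set V})
    (x w : V -> R) : posdef S -> regresses S D x w ->
  (subvec x D *m invmx (submat S D D) *m (subvec x D)^T) 0 0 = \sum_v w v * x v.
Proof.
by move=> pS rw; rewrite (regresses_subvec pS rw) subvec_dot //; case: rw.
Qed.

(** Both sides equal [x_D S_DD^-1 y_D^T], by symmetry of [S]. *)
Lemma regresses_swap (R : realType) (V : finType) (S : 'M[R]_#|V|) (D : {set V})
    (x y f g : V -> R) : posdef S -> regresses S D x f -> regresses S D y g ->
  \sum_v f v * y v = \sum_v g v * x v.
Proof.
move=> pS [fD fE] [gD gE].
have restr (h k : V -> R) : (forall v, v \notin D -> h v = 0) ->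
    \sum_v h v * k v = \sum_(v in D) h v * k v.
  move=> hD; rewrite (bigID (mem D)) /= [X in _ + X]big1 ?addr0 // => v vD.
  by rewrite hD // mul0r.
rewrite (restr f) // (restr g) //.
transitivity (\sum_(v in D) \sum_w f v * (g w * entry S w v)).
  by apply: eq_bigr => v vD; rewrite -mulr_sumr gE.
transitivity (\sum_(v in D) g v * \sum_w f w * entry S w v); last first.
  by apply: eq_bigr => v vD; rewrite fE.
have -> : \sum_(v in D) g v * (\sum_w f w * entry S w v) =
          \sum_v g v * (\sum_w f w * entry S w v) by rewrite restr.
under [RHS]eq_bigr => v _ do rewrite mulr_sumr.
rewrite [RHS]exchange_big /= [RHS](bigID (mem D)) /= [X in _ = _ + X]big1 ?addr0.
  apply: eq_bigr => v vD; apply: eq_bigr => w _.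
  by rewrite (entry_sym w v pS); ring.
by move=> v vD; rewrite big1 // => w _; rewrite fD //; ring.
Qed.

(** The chain rule for densities: the second factor is the conditional density of [X_u] given [X_D],
    normal with the regression as mean and [s] as variance. *)
Lemma marginal_density_setU1 (R : realType) (V : finType) (S : 'M[R]_#|V|)
    (D : {set V}) (u : V) (f x : V -> R) :
  posdef S -> u \notin D -> regresses S D (entry S u) f ->
  let s := entry S u u - \sum_w f w * entry S w u in
  marginal_density S (u |: D) x =
  marginal_density S D x *
    (expR (- ((x u - \sum_w f w * x w) ^+ 2 / s) / 2) / Num.sqrt (2 * pi * s)).
Proof.
move=> pS uD rf s.
have s_gt0 : 0 < s by exact: (residual_var_gt0 pS uD rf).
have [w rw] := regresses_exists D x pS.
have [fD fE] := rf; have [wD wE] := rw.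
have wS : \sum_v w v * entry S v u = \sum_v f v * x v.
  rewrite -(regresses_swap pS rw rf).
  by apply: eq_bigr => v _; rewrite (entry_sym v u pS).
(* [w'] adds to [w] a multiple of the residual [e_u - f]. As that residual is orthogonal to [D], the
   values on [D] are kept, and [al] is chosen to produce the value [x u] at [u]. *)
pose al := (x u - \sum_v f v * x v) / s.
pose w' v := w v + al * ((v == u)%:R - f v).
have sumw' (k : V -> R) : \sum_v w' v * k v =
    \sum_v w v * k v + al * (k u - \sum_v f v * k v).
  have -> : k u = \sum_v (v == u)%:R * k v.
    rewrite (bigD1 u) //= eqxx mul1r big1 ?addr0 // => v /negbTE ->.
    by rewrite mul0r.
  rewrite -sumrB mulr_sumr -big_split /=; apply: eq_bigr => v _; rewrite /w'; ring.
have rw' : regresses S (u |: D) x w'.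
  split=> [v|v].
    rewrite !inE negb_or => /andP[/negbTE vu vD].
    by rewrite /w' vu wD // fD // subr0 mulr0 addr0.
  rewrite sumw' !inE => /orP[/eqP->|vD].
    rewrite wS -/s /al divfK ?lt0r_neq0 //; ring.
  by rewrite wE // fE // subrr mulr0 addr0.
rewrite /marginal_density /normal_density.
rewrite (quad_form_submat pS rw') (quad_form_submat pS rw) sumw'.
rewrite (det_submat_setU1 pS uD rf) -/s cardsU1 uD add1n exprS.
set q := \sum_v w v * x v; set d := \det _; set m := _ ^+ #|D|.
have -> : 2 * pi * m * (s * d) = (m * d) * (2 * pi * s) by ring.
rewrite sqrtrM; last first.
  by rewrite mulr_ge0 ?exprn_ge0 ?mulr_ge0 ?pi_ge0 // ltW // det_submat_gt0.
have -> : - (q + al * (x u - \sum_v f v * x v)) / 2 =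
   - q / 2 + - ((x u - \sum_w0 f w0 * x w0) ^+ 2 / s) / 2.
  by rewrite /al expr2; ring.
by rewrite expRD invfM; ring.
Qed.

(** * Conditional independence and the Markov property of a precision matrix *)

(** The vertices of [A] are added one at a time. If the residual of [u] is uncorrelated with [B],
    the same [f] still regresses [u] once [B] joins the conditioning set, so both sides gain the
    same conditional density as a factor. *)
Lemma cond_indep_residual (R : realType) (V : finType) (S : 'M[R]_#|V|)
    (A B C : {set V}) :
  posdef S -> [disjoint A & B] -> [disjoint A & C] ->
  (forall (u : V) (D : {set V}) (f : V -> R), u \in A -> u \notin D -> C \subset D ->
     regresses S D (entry S u) f ->
     forall b, b \in B -> entry S u b - \sum_w f w * entry S w b = 0) ->
  cond_indep S A B C.
Proof.
move=> pS dAB dAC res x.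
suff main (E : {set V}) : E \subset A ->
    marginal_density S (E :|: B :|: C) x * marginal_density S C x
    = marginal_density S (E :|: C) x * marginal_density S (B :|: C) x.
  exact: main.
have [n] := ubnP #|E|; elim: n E => // n IH E cE EA.
have [->|[u uE]] := set_0Vmem E; first by rewrite !set0U mulrC.
have uA := subsetP EA u uE.
have uB : u \notin B by apply: contraL uA => uB; rewrite (disjointFl dAB).
have uC : u \notin C by apply: contraL uA => uC; rewrite (disjointFl dAC).
rewrite -(setD1K uE) -!setUA.
set E' := E :\ u.
have uE' : u \notin E' by rewrite !inE eqxx.
have uD : u \notin E' :|: C by rewrite in_setU negb_or uE'.
have uD' : u \notin E' :|: (B :|: C) by rewrite !in_setU !negb_or uE' uB uC.
have [f rf] := regresses_exists (E' :|: C) (entry S u) pS.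
have rf' : regresses S (E' :|: (B :|: C)) (entry S u) f.
  have [fD fE] := rf; split=> [v|v].
    by rewrite !in_setU !negb_or => /and3P[vE _ vC]; rewrite fD // in_setU negb_or vE.
  rewrite setUCA in_setU => /orP[vB|]; last exact: fE.
  apply/esym/eqP; rewrite -subr_eq0; apply/eqP.
  by apply: (res u _ f uA uD _ rf) => //; exact: subsetUr.
rewrite (marginal_density_setU1 x pS uD rf) (marginal_density_setU1 x pS uD' rf').
have := IH E'; rewrite -!setUA => {}IH.
rewrite mulrAC IH; first by rewrite mulrAC.
  by move: cE; rewrite (cardsD1 u) uE.
by apply: subset_trans EA; exact: subD1set.
Qed.

(* The part of the residual lying outside [A :|: D] is a null vector of the
   quadratic form of the precision matrix [K]. *)
Lemma residual_eq0 (R : realType) (V : finType) (K S : 'M[R]_#|V|) (A D : {set V})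
    (u b : V) (f : V -> R) :
  posdef K -> S *m K = 1%:M ->
  (forall x y, x \in A -> y \notin A :|: D -> entry K x y = 0) ->
  u \in A :|: D -> regresses S D (entry S u) f -> b \notin A ->
  entry S u b - \sum_w f w * entry S w b = 0.
Proof.
move=> pK SK KA uAD [fD fE] bA.
have SKE v w : \sum_z entry S v z * entry K z w = (v == w)%:R.
  have := congr1 (fun M : 'M_#|V| => M (enum_rank v) (enum_rank w)) SK.
  by rewrite !mxE sum_ord_entry (inj_eq enum_rank_inj) => <-.
pose r v := entry S u v - \sum_w f w * entry S w v.
have rD v : v \in D -> r v = 0 by move=> vD; rewrite /r fE // subrr.
have [bD|bD] := boolP (b \in D); first exact: rD.
(* As a row vector [r] is [(e_u - f) S], so multiplying it by [K] leaves [e_u - f]. *)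
have rK w : \sum_v r v * entry K v w = (u == w)%:R - f w.
  under eq_bigr => v _ do rewrite mulrBl mulr_suml.
  rewrite sumrB SKE exchange_big /=; congr (_ - _).
  under eq_bigr => z _.
    under eq_bigr => v _ do rewrite -mulrA.
    rewrite -mulr_sumr SKE; over.
  rewrite (bigD1 w) //= eqxx mulr1 big1 ?addr0 // => z /negbTE ->.
  by rewrite mulr0.
pose r' v := if v \in A :|: D then 0 else r v.
have r'b : r' b = r b by rewrite /r' inE (negbTE bA) (negbTE bD).
apply/eqP/negPn/negP; rewrite -/(r b) -r'b => rb.
have := posdef_form pK rb; rewrite big1 ?ltxx // => w _.
have [wAD|wAD] := boolP (w \in A :|: D); first by rewrite {2}/r' wAD mulr0.
(* Cutting [r] down to [r'] changes nothing at [w]: [r] vanishes on [D], and [K] vanishes between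
   [A] and [w]. At such a [w] the vector [e_u - f] is 0. *)
suff -> : \sum_v r' v * entry K v w = \sum_v r v * entry K v w.
  rewrite rK fD; last by apply: contra wAD => wD; rewrite inE wD orbT.
  case: eqP => [uw|_]; last by rewrite subrr mul0r.
  by case/negP: wAD; rewrite -uw.
apply: eq_bigr => v _; rewrite /r'; case: ifP => // /setUP[vA|vD].
  by rewrite (KA v w) // !mulr0.
by rewrite (rD v) // mul0r.
Qed.

Lemma compatible_precision (R : realType) (V : finType) (e : rel V)
    (K S : 'M[R]_#|V|) :
  posdef K -> posdef S -> S *m K = 1%:M ->
  (forall x y, x != y -> ~~ e x y -> entry K x y = 0) ->
  compatible e S.
Proof.
move=> pK pS SK Ke; split=> // T1 T2 T3 d12 d13 d23 sep.
apply: cond_indep_residual => // u D f uT1 uD T3D rf b bT2.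
(* Steps of [e'] never enter [D]. The set [A] for [residual_eq0] is what [u] reaches by them; it
   misses [b], since a path reaching [b] would avoid [T3]. *)
pose e' := [rel x y | e x y && (y \notin D)].
have e'D x q : path e' x q -> all [predC D] q.
  by elim: q x => //= y q IH x /andP[/andP[_ ->] /IH].
have uA : u \in [set w | connect e' u w] by rewrite inE connect0.
apply: (residual_eq0 pK SK _ _ rf (A := [set w | connect e' u w])).
- move=> x y; rewrite !inE negb_or => ux /andP[uy yD]; apply: Ke.
    by apply: contraNneq uy => <-.
  apply: contra uy => exy; apply: (connect_trans ux).
  by apply: connect1; rewrite /= exy.
- by rewrite in_setU uA.
- rewrite inE; apply/negP => /connectP[q0 pq0]; case/shortenP: pq0 => q pq uq _ lq.
  have : simple_path e u b q.
    rewrite /simple_path uq lq eqxx !andbT.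
    by apply: sub_path pq => x y /andP[].
  move/(sep _ _ _ uT1 bT2) => /=; rewrite (disjointFr d13 uT1) /=.
  move/hasP=> [y yq yT3]; have /allP/(_ y yq) /= := e'D _ _ pq.
  by rewrite (subsetP T3D).
Qed.

Lemma posdef_unitmx (R : realType) (n : nat) (K : 'M[R]_n) :
  posdef K -> K \in unitmx.
Proof.
case=> _ pK; rewrite -row_free_unit; apply: inj_row_free => v vK.
apply/eqP/negPn/negP => /pK.
by rewrite vK mul0mx mxE ltxx.
Qed.

Lemma posdef_invmx (R : realType) (n : nat) (K : 'M[R]_n) :
  posdef K -> posdef (invmx K).
Proof.
move=> pK; have uK := posdef_unitmx pK; case: pK => sK pK.
have sS : (invmx K)^T = invmx K by rewrite trmx_inv sK.
split=> // x x0.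
have := pK (x *m invmx K); rewrite mulmxKV // trmx_mul sS mulmxA; apply.
by apply: contra x0 => /eqP x0; rewrite -[x](mulmxKV uK) x0 mul0mx.
Qed.

(** * The precision matrix of a graph and the positivity of its inverse *)

(** Every degree is at most [#|V|], so with this weight the off-diagonal entries of a row sum to
    less than 1 in absolute value. *)
Definition graph_weight (R : realType) (V : finType) : R := (#|V|.+1)%:R^-1.

Definition graph_precision (R : realType) (V : finType) (e : rel V) : 'M[R]_#|V| :=
  \matrix_(i, j) ((i == j)%:R -
    graph_weight R V * (e (enum_val i) (enum_val j))%:R).

Lemma entry_graph_precision (R : realType) (V : finType) (e : rel V) (u v : V) :
  entry (graph_precision R e) u v = (u == v)%:R - graph_weight R V * (e u v)%:R.
Proof. by rewrite /entry mxE !enum_rankK (inj_eq enum_rank_inj). Qed.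

Lemma graph_weight_gt0 (R : realType) (V : finType) : 0 < graph_weight R V.
Proof. by rewrite invr_gt0 ltr0Sn. Qed.

Lemma graph_weight_card (R : realType) (V : finType) :
  graph_weight R V * #|V|%:R = 1 - graph_weight R V.
Proof.
have := graph_weight_gt0 R V; rewrite /graph_weight -(addn1 #|V|) natrD.
rewrite invr_gt0 => /lt0r_neq0 H; field; exact: H.
Qed.

(* [K] is diagonally dominant: [2 x_u x_v <= x_u^2 + x_v^2]. *)
Lemma graph_precision_posdef (R : realType) (V : finType) (e : rel V) :
  symmetric e -> posdef (graph_precision R e).
Proof.
move=> se; split=> [|x x0].
  by apply/matrixP=> i j; rewrite !mxE eq_sym se.
rewrite entry_form; set t := graph_weight R V.
pose q := \sum_v x 0 (enum_rank v) ^+ 2.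
have q0 : 0 < q.
  have [i xi] : exists i, x 0 i != 0.
    apply/existsP; rewrite -negb_forall; apply: contra x0 => /forallP x0.
    by apply/eqP/rowP=> i; rewrite mxE (eqP (x0 i)).
  rewrite /q (bigD1 (enum_val i)) //= enum_valK ltr_pwDl //.
    by rewrite exprn_even_gt0.
  by apply: sumr_ge0 => v _; rewrite sqr_ge0.
have tgt0 := graph_weight_gt0 R V.
suff : t * q <= \sum_v (\sum_u x 0 (enum_rank u) * entry (graph_precision R e) u v) *
     x 0 (enum_rank v).
  by apply: lt_le_trans; rewrite mulr_gt0.
have sum_cst (k : R) : \sum_(u : V) k = k * #|V|%:R.
  by rewrite sumr_const mulr_natr.
(* Since [t * #|V| = 1 - t], the double sum equals [q - (1 - t) * q]. The inequality can then be
   checked term by term. *)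
have -> : t * q = \sum_v \sum_u ((u == v)%:R * x 0 (enum_rank v) ^+ 2 -
    t * (x 0 (enum_rank u) ^+ 2 + x 0 (enum_rank v) ^+ 2) / 2).
  under [RHS]eq_bigr => v _.
    rewrite sumrB (bigD1 v) //= eqxx mul1r [X in _ + X - _]big1 ?addr0; last first.
      by move=> u /negbTE ->; rewrite mul0r.
    rewrite -mulr_suml -mulr_sumr big_split /= sum_cst -/q.
    over.
  rewrite sumrB -/q -mulr_suml -mulr_sumr big_split /= sum_cst -mulr_suml -/q.
  have := graph_weight_card R V; rewrite -/t => E.
  have -> : t * (q * #|V|%:R + q * #|V|%:R) / 2 = q * (t * #|V|%:R) by field.
  rewrite E; ring.
apply: ler_sum => v _; rewrite mulr_suml; apply: ler_sum => u _.
rewrite entry_graph_precision -/t.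
set X := x 0 (enum_rank u); set Y := x 0 (enum_rank v).
have -> : (u == v)%:R * Y ^+ 2 = X * (u == v)%:R * Y.
  by rewrite /X /Y; case: eqP => [->|_]; rewrite ?mulr1 ?mul1r ?mulr0 ?mul0r.
have H : X * (e u v)%:R * Y <= (X ^+ 2 + Y ^+ 2) / 2.
  case: (e u v); rewrite ?mulr1 ?mulr0 ?mul0r; last by nra.
  have := sqr_ge0 (X - Y); nra.
have : t * (X * (e u v)%:R * Y) <= t * ((X ^+ 2 + Y ^+ 2) / 2).
  by rewrite ler_pM2l.
by move=> H'; rewrite mulrBr mulrBl; lra.
Qed.

(* The row [x] of [invmx K] solves [x_u = [u == v] + t * sum_(w ~ u) x_w] with
   [t * #|V| < 1], so it has no negative minimum; positivity then spreads from
   [v] along the edges. *)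
Lemma graph_precision_inv_gt0 (R : realType) (V : finType) (e : rel V) (v u : V) :
  symmetric e -> connect e v u -> 0 < entry (invmx (graph_precision R e)) v u.
Proof.
move=> se; set K := graph_precision R e; set S := invmx K.
have uK : K \in unitmx by apply/posdef_unitmx/graph_precision_posdef.
set t := graph_weight R V; have t0 : 0 < t := graph_weight_gt0 R V.
have eqx w : entry S v w = (v == w)%:R + t * \sum_z entry S v z * (e z w)%:R.
  have := congr1 (fun M : 'M_#|V| => M (enum_rank v) (enum_rank w)) (mulVmx uK).
  rewrite !mxE sum_ord_entry (inj_eq enum_rank_inj) => <-.
  under eq_bigr => z _ do
    rewrite -/(entry S v z) -/(entry K z w) entry_graph_precision mulrBr mulrCA.
  rewrite sumrB -mulr_sumr (bigD1 w) //= eqxx mulr1 [X in _ + X - _]big1; last first.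
    by move=> z /negbTE ->; rewrite mulr0.
  by rewrite addr0 subrK.
have x_ge0 w : 0 <= entry S v w.
  case: (@Order.TotalTheory.arg_minP _ _ _ v xpredT (entry S v) isT) => m _ mmin.
  apply: le_trans (mmin w isT); rewrite leNgt; apply/negP => m0.
  (* Each term is either an entry, at least the minimum, or 0, above the negative minimum. With
     [eqx] this gives [x_m >= (1 - t) * x_m], impossible for negative [x_m]. *)
  have : #|V|%:R * entry S v m <= \sum_z entry S v z * (e z m)%:R.
    rewrite mulr_natl -sumr_const.
    apply: ler_sum => z _; case: (e z m); rewrite ?mulr1 ?mulr0 ?mmin //.
    exact: ltW.
  rewrite -(ler_pM2l t0) mulrA graph_weight_card -/t.
  have := eqx m; have : 0 <= (v == m)%:R :> R by rewrite ler0n.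
  nra.
have step w w' : e w w' -> 0 < entry S v w -> 0 < entry S v w'.
  move=> ew w0; rewrite eqx (bigD1 w) //= ew mulr1 ltr_wpDl ?ler0n //.
  rewrite mulr_gt0 // ltr_pwDl // sumr_ge0 // => z _.
  by rewrite mulr_ge0 ?ler0n.
have v0 : 0 < entry S v v.
  rewrite eqx eqxx ltr_pwDl // mulr_ge0 ?(ltW t0) // sumr_ge0 // => z _.
  by rewrite mulr_ge0 ?ler0n.
case/connectP=> q vq ->; elim/last_ind: q vq => //= q w IH.
by rewrite rcons_path last_rcons => /andP[/IH vq ew]; exact: step ew vq.
Qed.

(** * Squared correlations on a star *)

(* [w ^+ 2 / (H * W)] is the squared correlation of [h] and [z]; conditioning on
   [z] multiplies the correlation of [a] and [c] by [1 - w ^+ 2 / (H * W)] and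
   the variances of [a] and [c] by no less than that. *)
Lemma star_corr_lt (R : realType) (H A C W x y w r s q : R) :
  0 < H -> 0 < A -> 0 < C -> 0 < W -> 0 < x -> 0 < y -> 0 < w ->
  x ^+ 2 <= A * H -> y ^+ 2 <= C * H -> w ^+ 2 < W * H ->
  (x ^+ 2 < A * H) || (y ^+ 2 < C * H) ->
  r = x * y / H -> s = x * w / H -> q = y * w / H ->
  (r - s / W * q) ^+ 2 / ((A - s / W * s) * (C - q / W * q)) < r ^+ 2 / (A * C).
Proof.
move=> H0 A0 C0 W0 x0 y0 w0 xA yC wW xyl rE sE qE.
pose o := w ^+ 2 / (H * W); pose xi := x ^+ 2 / (A * H); pose eta := y ^+ 2 / (C * H).
have Hn := lt0r_neq0 H0; have An := lt0r_neq0 A0.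
have Cn := lt0r_neq0 C0; have Wn := lt0r_neq0 W0.
have AH0 : 0 < A * H by rewrite mulr_gt0.
have CH0 : 0 < C * H by rewrite mulr_gt0.
have HW0 : 0 < H * W by rewrite mulr_gt0.
have o0 : 0 < o by rewrite divr_gt0 ?exprn_gt0.
have o1 : o < 1 by rewrite ltr_pdivrMr // mul1r mulrC.
have xi1 : xi <= 1 by rewrite ler_pdivrMr // mul1r.
have eta1 : eta <= 1 by rewrite ler_pdivrMr // mul1r.
have lt1 : (xi < 1) || (eta < 1) by rewrite !ltr_pdivrMr // !mul1r.
have -> : r - s / W * q = r * (1 - o).
  by rewrite rE sE qE /o; field; rewrite Hn Wn.
have -> : A - s / W * s = A * (1 - xi * o).
  by rewrite sE /xi /o; field; rewrite Hn Wn An.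
have -> : C - q / W * q = C * (1 - eta * o).
  by rewrite qE /eta /o; field; rewrite Hn Wn Cn.
have X1 : 1 - o <= 1 - xi * o by nra.
have Y1 : 1 - o <= 1 - eta * o by nra.
have o1' : 0 < 1 - o by rewrite subr_gt0.
have P : (1 - o) ^+ 2 < (1 - xi * o) * (1 - eta * o).
  have ltM (k X Y : R) : 0 < k -> k < X -> k <= Y -> k ^+ 2 < X * Y.
    move=> k0 kX kY; have Y0 := lt_le_trans k0 kY.
    apply: (@le_lt_trans _ _ (k * Y)); first by rewrite expr2 ler_pM2l.
    by rewrite ltr_pM2r.
  case/orP: lt1 => l; first by apply: ltM => //; nra.
  by rewrite mulrC; apply: ltM => //; nra.
have r0 : 0 < r by rewrite rE divr_gt0 // mulr_gt0.
rewrite ltr_pdivrMr; last by rewrite !mulr_gt0 //; lra.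
have -> : r ^+ 2 / (A * C) * (A * (1 - xi * o) * (C * (1 - eta * o))) =
  r ^+ 2 * ((1 - xi * o) * (1 - eta * o)) by field; rewrite An Cn.
by rewrite exprMn ltr_pM2l // exprn_gt0.
Qed.

(** The other vertices of [D] are uncorrelated with both [u] and [h], so the regression on [h] alone
    already fits them. *)
Lemma regresses_single (R : realType) (V : finType) (S : 'M[R]_#|V|) (D : {set V})
    (u h : V) :
  0 < entry S h h -> h \in D ->
  (forall b, b \in D -> b != h -> entry S u b = 0 /\ entry S h b = 0) ->
  regresses S D (entry S u) (fun v => (v == h)%:R * (entry S u h / entry S h h)).
Proof.
move=> Sh hD z0; split=> [v vD|v vD].
  by case: eqP vD => [->|]; rewrite ?hD ?mul0r.
rewrite (bigD1 h) //= eqxx mul1r big1 ?addr0; last first.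
  by move=> w /negbTE ->; rewrite !mul0r.
have [->|vh] := eqVneq v h; first by rewrite divfK // lt0r_neq0.
by have [-> ->] := z0 v vD vh; rewrite mulr0.
Qed.

Lemma sum_single (R : realType) (V : finType) (h : V) (k : R) (F : V -> R) :
  \sum_v (v == h)%:R * k * F v = k * F h.
Proof.
rewrite (bigD1 h) //= eqxx mul1r big1 ?addr0 // => w /negbTE ->.
by rewrite !mul0r.
Qed.

(** [M1], [M2], [M3] are the arms without the centre. Edges between two arms and edges leaving the
    star are dropped, so that [h] separates the arms. *)
Definition star_rel (V : finType) (e : rel V) (h : V) (M1 M2 M3 : {set V}) : rel V :=
  [rel x y | e x y && [|| (x \in h |: M1) && (y \in h |: M1),
     (x \in h |: M2) && (y \in h |: M2) | (x \in h |: M3) && (y \in h |: M3)]].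

Lemma star_rel_sym (V : finType) (e : rel V) (h : V) (M1 M2 M3 : {set V}) :
  symmetric e -> symmetric (star_rel e h M1 M2 M3).
Proof. by move=> se x y; rewrite /star_rel /= se; do 3!rewrite (andbC (x \in _)). Qed.

(** Either [a] or [c] may be the centre itself, hence the membership in [h |: M1] and [h |: M2]. Of
    the star, [Z] contains no vertex and [Z'] only [z], which reduces the claim to
    [star_corr_lt]. *)
Lemma star_corr_decrease (R : realType) (V : finType) (e : rel V) (a c h z : V)
    (M1 M2 M3 Z Z' : {set V}) :
  symmetric e ->
  h \notin M1 :|: M2 :|: M3 ->
  [disjoint M1 & M2] -> [disjoint M1 & M3] -> [disjoint M2 & M3] ->
  a \in h |: M1 -> c \in h |: M2 -> z \in M3 -> a != c ->
  connect (star_rel e h M1 M2 M3) a h ->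
  connect (star_rel e h M1 M2 M3) c h ->
  connect (star_rel e h M1 M2 M3) z h ->
  (forall v, v \in h |: (M1 :|: M2 :|: M3) -> v \notin Z) ->
  z \in Z' ->
  (forall v, v \in h |: (M1 :|: M2 :|: M3) -> v \in Z' -> v = z) ->
  exists S : 'M[R]_#|V|, compatible e S /\
    partial_corr2 S Z' a c < partial_corr2 S Z a c.
Proof.
move=> se hM d12 d13 d23 aM cM zM ac ah ch zh TZ zZ' TZ'.
set e' := star_rel e h M1 M2 M3 in ah ch zh *.
have se' : symmetric e' by exact: star_rel_sym.
pose K := graph_precision R e'.
have pK : posdef K by exact: graph_precision_posdef.
pose S := invmx K; have pS : posdef S by exact: posdef_invmx.
have SK : S *m K = 1%:M by rewrite mulVmx // posdef_unitmx.
have K0 x y : x != y -> ~~ e' x y -> entry K x y = 0.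
  by move=> /negbTE xy /negbTE exy; rewrite entry_graph_precision xy exy mulr0 subrr.
have [hM1 [hM2 hM3]] : h \notin M1 /\ h \notin M2 /\ h \notin M3.
  by move: hM; rewrite !inE !negb_or -andbA => /and3P[-> -> ->].
exists S; split.
  apply: (compatible_precision pK pS SK) => x y xy /negP exy.
  by apply: K0 => //; apply/negP => /andP[].
have arm (M : {set V}) : h \notin M -> (M = M1 \/ M = M2 \/ M = M3) ->
    forall x y, x \in M -> y \notin M :|: [set h] -> entry K x y = 0.
  move=> hM' ME x y xM yM; apply: K0.
    by apply: contraNneq yM => <-; rewrite inE xM.
  have xh : (x == h) = false by apply: contraNF hM' => /eqP <-.
  have yM' : (y \in h |: M) = false.
    by apply: contraNF yM; rewrite !inE orbC.
  apply/negP => /andP[_]; rewrite !in_setU1 xh /=.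
  case: ME => [|[|]] E; subst M; move: yM'; rewrite in_setU1 => ->; rewrite ?andbF.
  - by rewrite (disjointFr d12) // (disjointFr d13).
  - by rewrite (disjointFl d12) // (disjointFr d23).
  - by rewrite (disjointFl d13) // (disjointFl d23).
pose T := h |: (M1 :|: M2 :|: M3).
have KT x y : x \in T -> y \notin T :|: set0 -> entry K x y = 0.
  rewrite setU0 => xT yT; apply: K0; first by apply: contraNneq yT => <-.
  apply: contra yT => /andP[_]; rewrite !inE.
  by case/or3P=> /andP[_ /orP[->|->]]; rewrite ?orbT.
have ST u b : u \in T -> b \notin T -> entry S u b = 0.
  move=> uT bT; have r0 : regresses S set0 (entry S u) (fun=> 0).
    by split=> // v; rewrite inE.
  have := residual_eq0 pK SK KT _ r0 bT; rewrite setU0 => /(_ uT).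
  by rewrite big1 ?subr0 // => w _; rewrite mul0r.
have Sgt0 u v : connect e' u v -> 0 < entry S u v.
  exact: graph_precision_inv_gt0.
have Sdiag u : 0 < entry S u u by apply: Sgt0; exact: connect0.
have rh u : regresses S [set h] (entry S u)
    (fun v => (v == h)%:R * (entry S u h / entry S h h)).
  apply: regresses_single => //; first exact: set11.
  by move=> b; rewrite inE => ->.
have Sarm (M : {set V}) u b : h \notin M -> (M = M1 \/ M = M2 \/ M = M3) ->
    u \in h |: M -> b \notin M ->
    entry S u b = entry S u h * entry S b h / entry S h h.
  move=> hM' ME uM bM.
  have := residual_eq0 pK SK (arm M hM' ME) _ (rh u) bM; rewrite setUC => /(_ uM).
  rewrite sum_single (entry_sym h b pS) => /eqP; rewrite subr_eq0 => /eqP ->.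
  by rewrite mulrAC.
(* Strict Cauchy-Schwarz, from the positive residual variance of [u] given [h]. *)
have var u : u != h -> entry S u h ^+ 2 < entry S u u * entry S h h.
  move=> uh; have uh' : u \notin [set h] by rewrite inE.
  have := residual_var_gt0 pS uh' (rh u); rewrite sum_single (entry_sym h u pS).
  by rewrite subr_gt0 mulrAC -expr2 ltr_pdivrMr.
have var_le u : entry S u h ^+ 2 <= entry S u u * entry S h h.
  have [->|/var/ltW//] := eqVneq u h; by rewrite expr2.
have MT : {subset h |: M1 <= T} /\ {subset h |: M2 <= T} /\ {subset M3 <= T}.
  by split=> [v|]; last split=> v; rewrite !inE; do ?case/orP; move=> ->; rewrite ?orbT.
have [aT [cT zT]] : a \in T /\ c \in T /\ z \in T.
  by case: MT => H1 [H2 H3]; rewrite H1 // H2 // H3.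
have pcZ u v : u \in T -> partial_cov S Z u v = entry S u v.
  move=> uT; rewrite (@partial_covE _ _ _ _ _ _ (fun=> 0)) //.
    by rewrite big1 ?subr0 // => w _; rewrite mul0r.
  split=> // w wZ; rewrite big1; last by move=> ? _; rewrite mul0r.
  by rewrite ST //; apply: contraL wZ; exact: TZ.
have pcZ' u v : u \in T ->
    partial_cov S Z' u v = entry S u v - entry S u z / entry S z z * entry S v z.
  move=> uT; rewrite (partial_covE _ pS (regresses_single (Sdiag z) zZ' _)).
    by rewrite sum_single (entry_sym z v pS).
  move=> b bZ' bz; have bT : b \notin T by apply: contra bz => /TZ'-> //; exact/eqP.
  by rewrite !ST.
have cM1 : c \notin M1.
  move: cM; rewrite in_setU1 => /orP[/eqP->//|cM]; by rewrite (disjointFl d12).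
have zM1 : z \notin M1 by rewrite (disjointFl d13).
have zM2 : z \notin M2 by rewrite (disjointFl d23).
rewrite /partial_corr2 !pcZ // !pcZ' //.
apply: (@star_corr_lt _ (entry S h h) _ _ _ (entry S a h) (entry S c h) (entry S z h));
  rewrite ?Sdiag ?Sgt0 //.
- by rewrite var //; apply: contraNneq hM3 => <-.
(* At most one of [a] and [c] is [h], and the other one gives the strict inequality. *)
- have [aE|/var->//] := eqVneq a h; rewrite (var c) ?orbT //.
  by apply: contra ac => /eqP->; rewrite aE.
- by apply: (Sarm M1) => //; left.
- by apply: (Sarm M1) => //; left.
- by apply: (Sarm M2) => //; right; left.
Qed.

(** * Paths from the path between [a] and [c] to the conditioning set *)

(** Induction on length: the path is restarted at an inner vertex of [P], or cut off at an inner
    vertex of [Z], until no inner vertex lies in either set. *)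
Lemma first_exit (V : finType) (e : rel V) (P Z : {set V}) (x : V) (q : seq V) :
  [disjoint P & Z] -> path e x q -> x \in P -> last x q \in Z ->
  exists h z q1, [/\ h \in P, z \in Z, path e h (rcons q1 z),
    {subset rcons q1 z <= q} & forall v, v \in q1 -> (v \notin P) && (v \notin Z)].
Proof.
move=> dPZ; have [n] := ubnP (size q); elim: n x q => // n IH x q.
case/lastP: q => [|q y] sq /=.
  by move=> _ xP; rewrite (disjointFr dPZ).
rewrite last_rcons => pq xP yZ.
have [/hasP[h hq hP]|noP] := boolP (has (mem P) q).
  case/splitPr: hq sq pq => s1 s2; rewrite rcons_cat cat_path /= => sq /and3P[_ _ pq].
  have sz : (size (rcons s2 y) < n)%N.
    by move: sq; rewrite size_cat /= size_rcons; lia.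
  have lZ : last h (rcons s2 y) \in Z by rewrite last_rcons.
  have [h' [z [q1 [? ? ? sub ?]]]] := IH _ _ sz pq hP lZ.
  exists h', z, q1; split=> // v /sub vq.
  by rewrite mem_cat inE vq !orbT.
have [/hasP[z zq zZ]|noZ] := boolP (has (mem Z) q).
  case/splitPr: zq sq pq noP => s1 s2; rewrite rcons_cat cat_path /=.
  move=> sq /and3P[p1 ez _] _.
  have sz : (size (rcons s1 z) < n)%N.
    by move: sq; rewrite size_rcons size_cat /= size_rcons; lia.
  have pz : path e x (rcons s1 z) by rewrite rcons_path p1.
  have lZ : last x (rcons s1 z) \in Z by rewrite last_rcons.
  have [h' [z' [q1 [? ? ? sub ?]]]] := IH _ _ sz pz xP lZ.
  exists h', z', q1; split=> // v /sub.
  by rewrite mem_rcons mem_cat !inE => /orP[->|->]; rewrite ?orbT.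
exists x, y, q; split=> // v vq.
by rewrite (hasPn noP) // (hasPn noZ).
Qed.

(** The arms are the two pieces of [a :: p] on either side of the exit vertex [h], and the path from
    [h] to the vertex [z] of [Z']. *)
Lemma exists_corr_decrease (R : realType) (V : finType) (e : rel V) (a c x : V)
    (p q : seq V) (Z Z' : {set V}) :
  symmetric e -> a != c -> simple_path e a c p -> [disjoint a :: p & Z :|: Z'] ->
  x \in [set a; c] -> path e x q -> last x q \in Z' -> ~~ has (mem Z) q ->
  exists S : 'M[R]_#|V|, compatible e S /\
    partial_corr2 S Z' a c < partial_corr2 S Z a c.
Proof.
move=> se ac /and3P[pp up /eqP lp] dP xac pq lq qZ.
pose P : {set V} := [set v in a :: p].
have PZ v : v \in a :: p -> (v \notin Z) && (v \notin Z').
  by move=> vP; have := disjointFr dP vP; rewrite in_setU => /negbT; rewrite negb_or.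
have dPZ : [disjoint P & Z'].
  by rewrite disjoint_subset; apply/subsetP=> v; rewrite !inE -in_cons => /PZ/andP[].
have xP : x \in P.
  case/set2P: xac => ->; rewrite inE ?mem_head //.
  by rewrite -lp mem_last.
have [h [z [q1 [hP zZ' pq1 sub q1P]]]] := first_exit dPZ pq xP lq.
have zP : z \notin P by rewrite (disjointFl dPZ).
move: hP; rewrite inE => hP.
(* The path is about to be split at [h], so its edges and end points are restated for a plain
   sequence. *)
have : sorted e (a :: p) by [].
have : last a (a :: p) = c by [].
have ahd : head h (a :: p) = a by [].
move: ahd hP PZ up; rewrite {}/P in xP dPZ q1P zP * .
move: (a :: p) xP dPZ q1P zP => s xP dPZ q1P zP ahd hP PZ us ls ss.
case/splitPr: hP xP dPZ q1P zP ahd PZ us ls ss => pa pc _ _ q1P zP ahd PZ us ls.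
rewrite sorted_cat_cons => /andP[ppa ppc].
have {}zP : z \notin pa ++ h :: pc by move: zP; rewrite inE.
have q1P' v : v \in rcons q1 z -> v \notin pa ++ h :: pc.
  by rewrite mem_rcons inE => /orP[/eqP->//|/q1P/andP[]]; rewrite inE.
pose M1 := [set v in pa]; pose M2 := [set v in pc]; pose M3 := [set v in rcons q1 z].
pose e' := star_rel e h M1 M2 M3.
have symc : connect_sym e' by apply: sym_connect_sym; exact: star_rel_sym.
have pathe' (M : {set V}) y s1 : M = M1 \/ M = M2 \/ M = M3 ->
    {subset y :: s1 <= h |: M} -> path e y s1 -> path e' y s1.
  move=> ME sM; apply: (@sub_in_path _ (mem (h |: M))); last exact/allP.
  move=> v w vM wM evw; rewrite /e' /star_rel /= evw.
  by move: ME vM wM => [|[|]] -> -> ->; rewrite ?orbT.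
move: (us); rewrite cat_uniq /= negb_or => /and4P[upa /andP[hpa /hasPn papc] hpc upc].
apply: (@star_corr_decrease _ _ e a c h z M1 M2 M3) => //.
- rewrite !inE !negb_or hpa hpc /=.
  by apply/negP => /q1P'; rewrite mem_cat mem_head orbT.
- rewrite disjoint_sym disjoint_subset; apply/subsetP => v; rewrite !inE; exact: papc.
- rewrite disjoint_sym disjoint_subset; apply/subsetP => v; rewrite !inE.
  by move=> /q1P'; rewrite mem_cat negb_or => /andP[].
- rewrite disjoint_sym disjoint_subset; apply/subsetP => v; rewrite !inE.
  by move=> /q1P'; rewrite mem_cat inE !negb_or => /and3P[].
- by rewrite -ahd /M1; case: (pa) => [|? ?]; rewrite !inE ?eqxx ?orbT.
- rewrite -ls last_cat /= !inE -in_cons; exact: mem_last.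
- by rewrite inE mem_rcons mem_head.
(* An empty [pa] means that [a] is [h]; otherwise [pa] starts with [a]. *)
- case: pa @M1 @e' symc pathe' ppa ahd {upa hpa papc us ls PZ q1P q1P' zP} =>
    [|a' pa'] M1 e' symc pathe' /= ppa ahd; first by rewrite ahd connect0.
  subst a'; apply/connectP; exists (rcons pa' h); last by rewrite last_rcons.
  apply: (pathe' M1) => //; first by left.
  by move=> v; rewrite -rcons_cons mem_rcons /M1 !inE.
- rewrite symc; apply/connectP; exists pc; last by rewrite -ls last_cat.
  apply: (pathe' M2) => //; first by right; left.
  by move=> v; rewrite !inE.
- rewrite symc; apply/connectP; exists (rcons q1 z); last by rewrite last_rcons.
  apply: (pathe' M3) => //; first by right; right.
  by move=> v; rewrite !inE.
- move=> v vT; have : v \in pa ++ h :: pc \/ v \in rcons q1 z.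
    move: vT; rewrite !inE mem_cat inE.
    by case/orP=> [->|/orP[/orP[->|->]|->]]; rewrite ?orbT; [left|left|left|right].
  by case=> [/PZ/andP[]//|/sub vq]; apply: (hasPn qZ).
- move=> v vT vZ'; move: vT; rewrite in_setU1 2!in_setU.
  have nP : v \notin pa ++ h :: pc by apply: contraL vZ' => /PZ/andP[].
  move: nP; rewrite mem_cat inE !negb_or => /and3P[/negbTE v1 /negbTE v2 /negbTE v3].
  rewrite !inE v1 v2 v3 /= mem_rcons inE => /orP[/eqP//|/q1P/andP[_]].
  by rewrite vZ'.
Qed.

(** If every path from [T] to [Z'] met [Z], then [Z] would separate [T] from [Z' :\: Z], and
    compatibility would give the independence. *)
Lemma dependence_path (R : realType) (V : finType) (e : rel V) (S : 'M[R]_#|V|)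
    (T Z Z' : {set V}) :
  compatible e S -> [disjoint T & Z :|: Z'] -> ~ cond_indep S T Z' Z ->
  exists x y q, [/\ x \in T, y \in Z', path e x q, last x q = y & ~~ has (mem Z) q].
Proof.
move=> [_ cS] dT nci; apply: contrapT => noq; apply: nci.
have dTZ : [disjoint T & Z] by apply: disjointWr dT; exact: subsetUl.
have dTZ' : [disjoint T & Z' :\: Z].
  apply: disjointWr dT; apply: (subset_trans (subsetDl _ _)); exact: subsetUr.
(* [Z] may meet [Z'], while compatibility speaks of disjoint sets; the unions with [Z] in the
   densities are the same for [Z'] and [Z' :\: Z]. *)
have -> : cond_indep S T Z' Z = cond_indep S T (Z' :\: Z) Z.
  by rewrite /cond_indep -!setUA setDE setUIl (setUC (~: Z)) setUCr setIT.
apply: cS => //.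
  by rewrite disjoint_subset; apply/subsetP => v; rewrite !inE => /andP[].
move=> x y q xT; rewrite inE => /andP[_ yZ'] /and3P[pq _ /eqP lq].
apply/negPn/negP; rewrite /= negb_or => /andP[_ qZ].
by apply: noq; exists x, y, q.
Qed.

Theorem theorem8 (R : realType) (V : finType) (e : rel V) (Sigma : 'M[R]_#|V|)
    (a c : V) (Z1 Z2 : {set V}) (p : seq V)
    (tree_e : is_tree e) (compatible_Sigma : compatible e Sigma)
    (neq_ac : a != c)
    (dep21 : ~ cond_indep Sigma [set a; c] Z2 Z1)
    (dep12 : ~ cond_indep Sigma [set a; c] Z1 Z2)
    (path_ac : simple_path e a c p)
    (disj_path : [disjoint a :: p & Z1 :|: Z2]) :
  (exists Sigma1 : 'M[R]_#|V|, compatible e Sigma1 /\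
     partial_corr2 Sigma1 Z1 a c > partial_corr2 Sigma1 Z2 a c) /\
  (exists Sigma2 : 'M[R]_#|V|, compatible e Sigma2 /\
     partial_corr2 Sigma2 Z2 a c > partial_corr2 Sigma2 Z1 a c).
Proof.
have [se _ _ _] := tree_e.
have acP : {subset [set a; c] <= a :: p}.
  move=> v /set2P[]->; first exact: mem_head.
  by case/and3P: path_ac => _ _ /eqP <-; exact: mem_last.
have dac : [disjoint [set a; c] & Z1 :|: Z2].
  by apply: disjointWl disj_path; apply/subsetP.
split.
  (* Dependence on [Z2] given [Z1] yields the matrix for which conditioning on [Z2] lowers the
     correlation; the other half exchanges the two sets. *)
  have [x [y [q [xac yZ pq lq qZ]]]] := dependence_path compatible_Sigma dac dep21.
  apply: (exists_corr_decrease R se neq_ac path_ac disj_path xac pq _ qZ).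
  by rewrite lq.
rewrite (setUC Z1) in dac disj_path.
have [x [y [q [xac yZ pq lq qZ]]]] := dependence_path compatible_Sigma dac dep12.
by apply: (exists_corr_decrease R se neq_ac path_ac disj_path xac pq _ qZ); rewrite lq.
Qed.
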